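(* For every integer $n\ge 2$ there is an open dense subset $\mathcal{A}$ of $E^n$ which is plurithin at $0$ and such that there exists no non-empty relatively open subset $C$ of a real hypersurface with $C\subset E^n\setminus\mathcal{A}$.
   Context: $E$ denotes the open unit disc of $\mathbb{C}$. A set $A\subset\mathbb{C}^n$ is called plurithin at a point $a\in\mathbb{C}^n$ if either $a\notin\overline{A}$, or $a\in\overline{A}$ and $\limsup_{A\setminus\{a\}\ni z\to a}u(z)<u(a)$ for a suitable function $u$ plurisubharmonic in a neighborhood of $a$. *)

(* Defs.v *)
(* MathComp / MathComp-Analysis, over an arbitrary realType. *)
From HB Require Import structures.
From mathcomp Require Import all_boot all_order all_algebra.
From mathcomp Require Import all_classical all_reals all_analysis.
From mathcomp Require Import complex.

Set Implicit Arguments.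
Unset Strict Implicit.
Unset Printing Implicit Defensive.

Import Order.TTheory GRing.Theory Num.Theory.
Import numFieldNormedType.Exports.

Local Open Scope classical_set_scope.
Local Open Scope ring_scope.

(* Packing R[i] as a numClosedFieldType lets the generic topology of numeric
   fields (balls of the complex modulus) be inferred on it; 'rV[Cplx R]_n then
   carries the product topology. *)
Definition Cplx (R : realType) : numClosedFieldType := R[i]%C.

Definition polydisc (R : realType) (n : nat) : set 'rV[Cplx R]_n :=
  [set z | forall j, `|z ord0 j| < 1].

Definition usc_on (R : realType) (T : topologicalType) (D : set T)
    (u : T -> \bar R) : Prop :=
  forall x, D x -> forall c : R, (u x < c%:E)%E ->
    \forall y \near x, D y -> (u y < c%:E)%E.

Definition expi (R : realType) (t : R) : Cplx R := (cos t +i* sin t)%C.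

(* The values on the circle lie in [-oo, +oo[ and are bounded above for the
   functions considered, so that the integral is meaningful, possibly -oo. *)
Definition circle_mean (R : realType) (f : Cplx R -> \bar R) (a : Cplx R)
    (r : R) : \bar R :=
  (((2 * pi)^-1)%:E *
   \int[lebesgue_measure]_(t in `[0%R, (2 * pi)%R])
     f (a + (r%:C)%C * expi t)%R)%E.

Definition subharmonic (R : realType) (D : set (Cplx R))
    (f : Cplx R -> \bar R) : Prop :=
  [/\ open D,
      forall z, D z -> (f z < +oo)%E,
      usc_on D f &
      forall (a : Cplx R) (r : R), 0 < r ->
        [set z | `|z - a| <= (r%:C)%C] `<=` D ->
        (f a <= circle_mean f a r)%E].

(* The function identically -oo is allowed, here and in the slices. *)
Definition plurisubharmonic (R : realType) (n : nat) (U : set 'rV[Cplx R]_n)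
    (u : 'rV[Cplx R]_n -> \bar R) : Prop :=
  [/\ open U,
      forall z, U z -> (u z < +oo)%E,
      usc_on U u &
      forall a b : 'rV[Cplx R]_n,
        subharmonic [set l : Cplx R | U (a + l *: b)]
                    (fun l => u (a + l *: b))].

Definition plurithin (R : realType) (n : nat) (A : set 'rV[Cplx R]_n)
    (a : 'rV[Cplx R]_n) : Prop :=
  ~ closure A a \/
  (closure A a /\
   exists (U : set 'rV[Cplx R]_n) (u : 'rV[Cplx R]_n -> \bar R),
     [/\ U a, plurisubharmonic U u &
         (limf_esup u (within (A `\ a) (nbhs a)) < u a)%E]).

(* The standard basis of C^n = R^(2n): direction of x_j for b = false and
   of y_j for b = true, where z_j = x_j + i y_j. *)
Definition real_dir (R : realType) (n : nat) (j : 'I_n) (b : bool) :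
    'rV[Cplx R]_n :=
  (if b then 'i else 1) *: delta_mx ord0 j.

(* C^n as defined here is a normed space over C only, hence real partial
   derivatives are taken along real lines. *)
Definition real_line (R : realType) (n : nat) (rho : 'rV[Cplx R]_n -> R)
    (z v : 'rV[Cplx R]_n) : R -> R :=
  fun t => rho (z + (t%:C)%C *: v).

Definition real_partial (R : realType) (n : nat) (rho : 'rV[Cplx R]_n -> R)
    (j : 'I_n) (b : bool) (z : 'rV[Cplx R]_n) : R :=
  'D_1 (real_line rho z (real_dir R j b)) 0.

Definition C1_on (R : realType) (n : nat) (U : set 'rV[Cplx R]_n)
    (rho : 'rV[Cplx R]_n -> R) : Prop :=
  forall (j : 'I_n) (b : bool) z, U z ->
    derivable (real_line rho z (real_dir R j b)) 0 1 /\
    {for z, continuous (real_partial rho j b)}.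

(* Embedded real hypersurfaces of class C^1, not necessarily closed. *)
Definition real_hypersurface (R : realType) (n : nat)
    (M : set 'rV[Cplx R]_n) : Prop :=
  forall p, M p ->
    exists (U : set 'rV[Cplx R]_n) (rho : 'rV[Cplx R]_n -> R),
      [/\ open U, U p, C1_on U rho,
          forall z, U z -> exists j b, real_partial rho j b z != 0 &
          M `&` U = [set z | U z /\ rho z = 0]].

(* Main.v *)
Require Import Defs.
From HB Require Import structures.
From mathcomp Require Import all_boot all_order all_algebra.
From mathcomp Require Import all_classical all_reals all_analysis.
From mathcomp Require Import complex.
From mathcomp Require Import measurable_realfun ring lra.

Set Implicit Arguments.
Unset Strict Implicit.
Unset Printing Implicit Defensive.

Import Order.TTheory GRing.Theory Num.Theory.
Import numFieldNormedType.Exports.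

Local Open Scope classical_set_scope.
Local Open Scope ring_scope.

(* Let the hyperplanes {z_k = a}, for all k and all a <> 0 in a countable dense
   subset of the disc, be enumerated by m, and let u = - sum_m w_m with
     w_m(z) = eps_m (ln 5 - ln (|z_k - a|^2 + e_m)).
   Each w_m is superharmonic along complex lines and nonnegative on E^n, so u is
   plurisubharmonic; eps_m and then e_m are chosen so small that w_m(0) <= 2^-(m+1),
   while w_m >= 3 on its hyperplane.  Hence A = {z in E^n | u(z) < -2} is open,
   contains every hyperplane of the family, and is plurithin at 0 as u(0) >= -1.
   A local equation rho of a hypersurface changes sign along a segment parallel to
   some coordinate axis j.  Moving the segment slightly in a coordinate k <> j puts
   it inside one of the hyperplanes {z_k = a}, and there rho still vanishes
   somewhere, so that the hypersurface meets A.
   The submean inequality follows from the duplication identity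
     |c + d w|^2 |c - d w|^2 = |c^2 - d^2 w^2|^2,   |w| = 1,
   in its regularised form: iterating it, the mean of ln (|c + d w|^2 + e) over the
   circle is bounded below up to an error divided by arbitrary powers of 2. *)

(** * Circular means of logarithms of trigonometric polynomials of degree one *)

Section mean_of_log.
Context {R : realType}.
Implicit Types A B C X rho : R.

Let trigpoly A B C (t : R) := A + B * cos t + C * sin t.

(** Put [beta = (B - i C) / (2 X)]. The hypotheses say that [|beta| <= rho] and
    [A >= X (1 + |beta|^2)], so the polynomial is at least [X |1 + beta exp(it)|^2]. The proof is
    this computation multiplied by [4 X], with [y] bounded by Cauchy-Schwarz. *)
Lemma trigpoly_lower_bound A B C X rho t : 0 < X -> rho < 1 -> 0 <= rho ->
  B ^+ 2 + C ^+ 2 <= 4 * rho ^+ 2 * X ^+ 2 ->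
  4 * X ^+ 2 + (B ^+ 2 + C ^+ 2) <= 4 * A * X ->
  X * (1 - rho) ^+ 2 <= trigpoly A B C t.
Proof.
move=> X0 rho1 rho0 Srho SA; rewrite /trigpoly -addrA.
set y := B * cos t + C * sin t.
have yS : y ^+ 2 <= B ^+ 2 + C ^+ 2.
  have := sqr_ge0 (B * sin t - C * cos t).
  have -> : B ^+ 2 + C ^+ 2 = (B ^+ 2 + C ^+ 2) * (cos t ^+ 2 + sin t ^+ 2).
    by rewrite cos2Dsin2 mulr1.
  by rewrite /y; nra.
have yrho : - (2 * rho * X) <= y.
  have h0 : 0 <= 2 * rho * X by rewrite !mulr_ge0// ltW.
  have : `|y| <= 2 * rho * X.
    by rewrite -ler_sqr ?nnegrE// real_normK ?num_real//; nra.
  by rewrite ler_norml => /andP[].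
rewrite -(ler_pM2r (_ : 0 < 4 * X)); last by rewrite mulr_gt0.
apply: (@le_trans _ _ ((2 * X + y) ^+ 2)); last by nra.
have -> : X * (1 - rho) ^+ 2 * (4 * X) = (2 * X * (1 - rho)) ^+ 2 by ring.
have h0 : 0 <= 2 * X * (1 - rho).
  by rewrite !mulr_ge0 ?subr_ge0// ltW.
rewrite ler_sqr ?nnegrE//; first nra.
by nra.
Qed.

(** An open neighbourhood of the period that both [t / 2] and [t / 2 + pi] map into itself, so that
    the iteration keeps two-sided derivatives at the endpoints. *)
Let dom := `]-1, (2 * pi + 1)[ : interval R.

(** The half-angles [t / 2] and [t / 2 + pi] give opposite points of the circle, so the product is
    [A^2 - y^2] with [y^2] quadratic in the half-angle, hence of degree one in [t]. *)
Lemma trigpoly_doubling A B C t :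
  trigpoly A B C (t / 2) * trigpoly A B C (t / 2 + pi) =
  trigpoly (A ^+ 2 - (B ^+ 2 + C ^+ 2) / 2) (- (B ^+ 2 - C ^+ 2) / 2)
    (- (B * C)) t.
Proof.
have ht : t = (t / 2) *+ 2 by rewrite -mulr_natr divfK.
have ct : cos t = cos (t / 2) ^+ 2 *+ 2 - 1 by rewrite [in LHS]ht cos_mulr2n.
have st : sin t = cos (t / 2) * sin (t / 2) *+ 2 by rewrite [in LHS]ht sin_mulr2n.
rewrite /trigpoly cosDpi sinDpi ct st.
have h : sin (t / 2) ^+ 2 = 1 - cos (t / 2) ^+ 2.
  by have := cos2Dsin2 (t / 2); lra.
by field: h.
Qed.

(* Averaging over the half-turn squares X, by the duplication identity above,
   and doubles the increment of the primitive. *)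
Lemma log_trigpoly_mean_iter k A B C X rho (F : R -> R) :
  0 < X -> rho < 1 -> 0 <= rho ->
  B ^+ 2 + C ^+ 2 <= 4 * rho ^+ 2 * X ^+ 2 ->
  4 * X ^+ 2 + (B ^+ 2 + C ^+ 2) <= 4 * A * X ->
  (forall t, t \in dom -> is_derive t 1 F (ln (trigpoly A B C t))) ->
  2 * pi * (2 ^+ k * ln X + ln ((1 - rho) ^+ 2)) <=
  2 ^+ k * (F (2 * pi) - F 0).
Proof.
move=> X0 rho1 rho0.
have twopi : (0 : R) < 2 * pi by rewrite mulr_gt0// pi_gt0.
elim: k A B C X F X0 => [|k IH] A B C X F X0 Srho SA dF.
  have sub x : x \in `[0, 2 * pi] -> x \in dom.
    by rewrite /dom !in_itv/=; lra.
  have dF' x : x \in `]0, (2 * pi)[ -> is_derive x 1 F (ln (trigpoly A B C x)).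
    by move=> xI; apply: dF; apply: sub; move: xI; rewrite !in_itv/=; lra.
  have cF : {within `[0, (2 * pi)], continuous F}.
    by apply: derivable_within_continuous => x /sub /dF [].
  have [x xI ->] := MVT twopi dF' cF.
  rewrite expr0 !mul1r subr0 mulrC ler_pM2r//.
  have r0 : 0 < (1 - rho) ^+ 2 by rewrite exprn_gt0// subr_gt0.
  have low := trigpoly_lower_bound x X0 rho1 rho0 Srho SA.
  have low0 : 0 < X * (1 - rho) ^+ 2 by rewrite (mulr_gt0 X0 r0).
  by rewrite -lnM ?posrE// ler_ln ?posrE// (lt_le_trans low0 low).
(* The derivative of [G] is the logarithm of the product of the two values; in [G (2 * pi) - G 0]
   the two terms [F pi] cancel. *)
pose G t : R := 2 * (F (t / 2) + F (t / 2 + pi)).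
have -> : 2 ^+ k.+1 * (F (2 * pi) - F 0) = 2 ^+ k * (G (2 * pi) - G 0).
  have e : 2 * pi / 2 = pi :> R by lra.
  have e2 : pi + pi = 2 * pi :> R by lra.
  by rewrite /G mul0r add0r e e2 exprSr; lra.
have -> : 2 ^+ k.+1 * ln X = 2 ^+ k * ln (X ^+ 2).
  by rewrite expr2 lnM ?posrE// exprSr; ring.
apply: (IH (A ^+ 2 - (B ^+ 2 + C ^+ 2) / 2) (- (B ^+ 2 - C ^+ 2) / 2) (- (B * C))).
- by rewrite exprn_gt0.
(* The ratio [(B^2 + C^2) / (4 X^2)] gets squared; it stays below [rho^4 <= rho^2], so the same
   [rho] serves at every stage. *)
- have -> : (- (B ^+ 2 - C ^+ 2) / 2) ^+ 2 + (- (B * C)) ^+ 2 =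
    (B ^+ 2 + C ^+ 2) ^+ 2 / 4 by field.
  have S0 : 0 <= B ^+ 2 + C ^+ 2 by rewrite addr_ge0// sqr_ge0.
  set S := B ^+ 2 + C ^+ 2 in Srho S0 *.
  have : S ^+ 2 <= (4 * rho ^+ 2 * X ^+ 2) ^+ 2.
    by rewrite ler_sqr ?nnegrE// (le_trans S0).
  have : rho ^+ 4 <= rho ^+ 2 by apply: ler_wiXn2l => //; exact: ltW.
  have : 0 <= X ^+ 4 by rewrite exprn_ge0// ltW.
  set X4 := X ^+ 4; set r4 := rho ^+ 4; set r2 := rho ^+ 2.
  have -> : (4 * r2 * X ^+ 2) ^+ 2 = 16 * r4 * X4 by rewrite /r2 /r4 /X4; ring.
  have -> : (X ^+ 2) ^+ 2 = X4 by rewrite /X4; ring.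
  by move=> X40 /(ler_wpM2r X40); lra.
(* Squaring the old condition on [A] and dividing by 4 gives the new one. *)
- have -> : (- (B ^+ 2 - C ^+ 2) / 2) ^+ 2 + (- (B * C)) ^+ 2 =
    (B ^+ 2 + C ^+ 2) ^+ 2 / 4 by field.
  have S0 : 0 <= B ^+ 2 + C ^+ 2 by rewrite addr_ge0// sqr_ge0.
  set S := B ^+ 2 + C ^+ 2 in SA S0 *.
  have : (4 * X ^+ 2 + S) ^+ 2 <= (4 * A * X) ^+ 2.
    have h : 0 <= 4 * X ^+ 2 + S by rewrite addr_ge0// mulr_ge0// sqr_ge0.
    by rewrite ler_sqr ?nnegrE// (le_trans h).
  by lra.
move=> t; rewrite /dom in_itv/= => /andP[t1 t2].
have pi0 := pi_gt0 R.
have d1 : is_derive (t / 2) 1 F (ln (trigpoly A B C (t / 2))).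
  by apply: dF; rewrite /dom in_itv/=; lra.
have d2 : is_derive (t / 2 + pi) 1 F (ln (trigpoly A B C (t / 2 + pi))).
  by apply: dF; rewrite /dom in_itv/=; lra.
have p0 u : 0 < trigpoly A B C u.
  apply: lt_le_trans (trigpoly_lower_bound _ X0 rho1 rho0 Srho SA).
  by rewrite mulr_gt0// exprn_gt0// subr_gt0.
have h1 : is_derive t 1 (fun x : R => x / 2) (2^-1).
  by apply: is_derive_eq; rewrite /GRing.scale/=; lra.
have h2 : is_derive t 1 (fun x : R => x / 2 + pi) (2^-1).
  by apply: is_derive_eq; rewrite /GRing.scale/=; lra.
have e1 := @is_derive1_comp R F (fun x : R => x / 2) t _ _ d1 h1.
have e2 := @is_derive1_comp R F (fun x : R => x / 2 + pi) t _ _ d2 h2.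
rewrite -trigpoly_doubling lnM ?posrE//.
have -> : G = 2 \*: ((F \o (fun x : R => x / 2)) \+ (F \o (fun x : R => x / 2 + pi))).
  by apply/funext => x.
apply: is_derive_eq.
by rewrite /GRing.scale/=; field.
Qed.

(** The error term of the iteration does not depend on [k], so a positive deficit [y] would keep all
    the [2^k y] below a fixed bound. *)
Lemma log_trigpoly_mean A B C X rho (F : R -> R) :
  0 < X -> rho < 1 -> 0 <= rho ->
  B ^+ 2 + C ^+ 2 <= 4 * rho ^+ 2 * X ^+ 2 ->
  4 * X ^+ 2 + (B ^+ 2 + C ^+ 2) <= 4 * A * X ->
  (forall t, t \in dom -> is_derive t 1 F (ln (A + B * cos t + C * sin t))) ->
  2 * pi * ln X <= F (2 * pi) - F 0.
Proof.
move=> X0 rho1 rho0 Srho SA dF.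
rewrite leNgt; apply/negP; rewrite -subr_gt0; set y := _ - _ => y0.
set M := - (2 * pi * ln ((1 - rho) ^+ 2)).
have bnd k : 2 ^+ k * y <= M.
  have := @log_trigpoly_mean_iter k _ _ _ _ _ _ X0 rho1 rho0 Srho SA dF.
  rewrite /M /y; set p := 2 ^+ k; nra.
have M0 : 0 <= M / y.
  apply: divr_ge0 => //; last exact: ltW.
  by apply: le_trans (bnd 0%N); rewrite expr0 mul1r ltW.
have := bnd (Num.bound (M / y)); apply/negP; rewrite -ltNge -ltr_pdivrMr//.
apply: lt_le_trans (archi_boundP M0) _.
by rewrite -natrX ler_nat ltnW// ltn_expl.
Qed.

End mean_of_log.

(** * Integrals over a period and the mean inequality for the regularised logarithm *)

Lemma primitive_on_period {R : realType} (f : R -> R) : continuous f ->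
  exists F : R -> R,
    forall t, t \in `]-1, (2 * pi + 1)[ -> is_derive t 1 F (f t).
Proof.
(* The base point -2 lies to the left of the whole interval, so each [t] is interior to the domain
   of integration. *)
move=> cf; exists (fun x => \int[lebesgue_measure]_(t in `[-2, x]) f t) => t.
rewrite in_itv/= => /andP[t1 t2].
have [||||dF FE] := @continuous_FTC1 R f (BLeft (-2)) t (2 * pi + 1).
- exact: t2.
- apply: continuous_compact_integrable; first exact: segment_compact.
  exact: continuous_subspaceT.
- by rewrite lte_fin; lra.
- exact: cf.
by rewrite derive1E in FE; exact: DeriveDef dF FE.
Qed.

Lemma integral_period {R : realType} (f F : R -> R) : continuous f ->
  (forall t, t \in `]-1, (2 * pi + 1)[ -> is_derive t 1 F (f t)) ->
  (\int[lebesgue_measure]_(t in `[0%R, (2 * pi)%R]) (f t)%:E =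
   (F (2 * pi)%R - F 0%R)%:E)%E.
Proof.
move=> cf dF.
have twopi : (0 : R) < 2 * pi by rewrite mulr_gt0// pi_gt0.
have sub t : t \in `[0, (2 * pi)] -> is_derive t 1 F (f t).
  by rewrite in_itv/= => tI; apply: dF; rewrite in_itv/=; lra.
have cF t : t \in `[0, (2 * pi)] -> {for t, continuous F}.
  move=> /sub dFt; apply: differentiable_continuous.
  by apply/derivable1_diffP; case: dFt.
rewrite (@continuous_FTC2 _ f F)//.
- exact: continuous_subspaceT.
- split.
  + by move=> t /subset_itv_oo_cc/sub[].
  + by apply: cvg_at_right_filter; apply: cF; rewrite in_itv/= lexx ltW.
  + by apply: cvg_at_left_filter; apply: cF; rewrite in_itv/= lexx ltW.
- move=> t /subset_itv_oo_cc/sub dFt.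
  by rewrite derive1E derive_val.
Qed.

(** The norm on [Cplx R] takes values in [Cplx R]; a real-valued square is needed for [ln]. *)
Definition sqmod {R : realType} (z : Cplx R) : R :=
  complex.Re z ^+ 2 + complex.Im z ^+ 2.

Lemma sqmod_ge0 {R : realType} (z : Cplx R) : 0 <= sqmod z.
Proof. by rewrite addr_ge0// sqr_ge0. Qed.

Lemma sqmod_circle {R : realType} (c d : Cplx R) (t : R) :
  sqmod (c + d * expi t) = sqmod c + sqmod d
    + 2 * (complex.Re c * complex.Re d + complex.Im c * complex.Im d) * cos t
    + 2 * (complex.Im c * complex.Re d - complex.Re c * complex.Im d) * sin t.
Proof.
have h : sin t ^+ 2 = 1 - cos t ^+ 2 by have := cos2Dsin2 t; lra.
case: c d => [c1 c2] [d1 d2]; rewrite /sqmod /=.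
by ring: h.
Qed.

Lemma continuous_ln_sqmod_circle {R : realType} (c d : Cplx R) (e : R) : 0 < e ->
  continuous (fun t : R => ln (sqmod (c + d * expi t) + e)).
Proof.
move=> e0 t.
have cP : continuous (fun t : R => sqmod (c + d * expi t) + e).
  under eq_fun do rewrite sqmod_circle.
  move=> s; do 3?[apply: cvgD]; try exact: cvg_cst; apply: cvgM;
    try exact: cvg_cst; [exact: continuous_cos|exact: continuous_sin].
apply: (continuous_comp (cP t)).
by apply: continuous_ln; rewrite ltr_wpDl// sqmod_ge0.
Qed.

(** The stronger bound [ln (M + e)] is proved, where [M] is the larger of the two squared moduli.
    With [X = M + e] one may take [rho = M / (M + e)]: here [e > 0] gives [rho < 1] even when
    [c + d w] vanishes on the circle. *)
Lemma log_sqmod_mean {R : realType} (c d : Cplx R) (e : R) (F : R -> R) :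
  0 < e ->
  (forall t, t \in `]-1, (2 * pi + 1)[ ->
    is_derive t 1 F (ln (sqmod (c + d * expi t) + e))) ->
  2 * pi * ln (sqmod c + e) <= F (2 * pi) - F 0.
Proof.
move=> e0 dF.
set x := sqmod c; set y := sqmod d; set M := Num.max x y.
have x0 : 0 <= x := sqmod_ge0 c.
have y0 : 0 <= y := sqmod_ge0 d.
have xM : x <= M by rewrite le_max lexx.
have yM : y <= M by rewrite le_max lexx orbT.
have xy : x * y <= (x + y - M) * M.
  by rewrite /M; case: (leP x y) => _; lra.
have Me : 0 < M + e by rewrite ltr_wpDl// (le_trans x0).
apply: (@le_trans _ _ (2 * pi * ln (M + e))).
  rewrite ler_pM2l ?mulr_gt0 ?pi_gt0// ler_ln ?posrE//; first by rewrite lerD2r.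
  by rewrite ltr_wpDl.
pose B := 2 * (complex.Re c * complex.Re d + complex.Im c * complex.Im d).
pose C := 2 * (complex.Im c * complex.Re d - complex.Re c * complex.Im d).
have S : B ^+ 2 + C ^+ 2 = 4 * x * y by rewrite /B /C /x /y /sqmod; ring.
apply: (@log_trigpoly_mean _ (x + y + e) B C (M + e) (M / (M + e))) => //.
- by rewrite ltr_pdivrMr// mul1r ltrDl.
- by apply: divr_ge0; [exact: le_trans x0 xM|exact: ltW].
- have -> : 4 * (M / (M + e)) ^+ 2 * (M + e) ^+ 2 = 4 * (M * M).
    by field; rewrite gt_eqF.
  by rewrite S -mulrA ler_pM2l// ler_pM.
- have : 0 <= e * (x + y - M).
    by rewrite mulr_ge0 ?(ltW e0)// /M; case: (leP x y) => _; lra.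
  by rewrite S; lra.
move=> t /dF; rewrite sqmod_circle -/x -/y -/B -/C.
by have -> : x + y + B * cos t + C * sin t + e = x + y + e + B * cos t + C * sin t
  by ring.
Qed.

(* The regularised logarithm [- ln (|z - a|^2 + e)] is superharmonic. *)
Lemma integral_neg_log_le {R : realType} (c d : Cplx R) (e eps k : R) :
  0 < e -> 0 <= eps ->
  (\int[lebesgue_measure]_(t in `[0%R, (2 * pi)%R])
     (eps * (k - ln (sqmod (c + d * expi t) + e)))%:E <=
   (2 * pi * (eps * (k - ln (sqmod c + e))))%:E)%E.
Proof.
move=> e0 eps0.
have cln := @continuous_ln_sqmod_circle R c d e e0.
have [F dF] := primitive_on_period cln.
have mean := log_sqmod_mean e0 dF.
pose f t := eps * (k - ln (sqmod (c + d * expi t) + e)).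
have cf : continuous f.
  move=> t; apply: cvgM; first exact: cvg_cst.
  by apply: cvgB; [exact: cvg_cst|exact: cln].
have dG t : t \in `]-1, (2 * pi + 1)[ ->
    is_derive t 1 (fun t => eps * (k * t - F t)) (f t).
  move=> /dF dFt; apply: is_derive_eq.
  by rewrite /f /GRing.scale/=; lra.
rewrite (integral_period cf dG) lee_fin.
by have := ler_wpM2l eps0 mean; lra.
Qed.

(** * Topology of the complex plane and of the polydisc *)

Lemma normCplxE {R : realType} (z : Cplx R) : `|z| = ((Num.sqrt (sqmod z))%:C)%C.
Proof. exact: normc_def. Qed.

Lemma normCplx_lt1 {R : realType} (z : Cplx R) : (`|z| < 1) = (sqmod z < 1).
Proof. by rewrite normCplxE (ltcR _ 1) -[in LHS]sqrtr1 ltr_sqrt. Qed.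

Lemma continuous_Re {R : realType} : continuous (fun z : Cplx R => complex.Re z : R).
Proof.
move=> z A /nbhs_ballP[e /= e0 eA]; apply/nbhs_ballP; exists (e%:C)%C => /=; first by rewrite (ltcR 0).
move=> w; rewrite /ball/= normCplxE ltcR => zw.
apply: eA; apply: le_lt_trans zw.
rewrite -sqrtr_sqr ler_wsqrtr//.
by case: (z) (w) => [? ?] [? ?]; rewrite /sqmod/= lerDl sqr_ge0.
Qed.

Lemma continuous_Im {R : realType} : continuous (fun z : Cplx R => complex.Im z : R).
Proof.
move=> z A /nbhs_ballP[e /= e0 eA]; apply/nbhs_ballP; exists (e%:C)%C => /=; first by rewrite (ltcR 0).
move=> w; rewrite /ball/= normCplxE ltcR => zw.
apply: eA; apply: le_lt_trans zw.
rewrite -sqrtr_sqr ler_wsqrtr//.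
by case: (z) (w) => [? ?] [? ?]; rewrite /sqmod/= lerDr sqr_ge0.
Qed.

Lemma continuous_sqmod {R : realType} : continuous (@sqmod R).
Proof.
have -> : @sqmod R = fun z =>
    complex.Re z * complex.Re z + complex.Im z * complex.Im z.
  by apply/funext => z; rewrite /sqmod !expr2.
move=> z; apply: (@cvgD _ _ _ _ (nbhs_filter z));
  apply: (@cvgM R _ _ (nbhs_filter z)); first [exact: continuous_Re|exact: continuous_Im].
Qed.

Lemma open_polydisc {R : realType} n : open (@polydisc R n).
Proof.
rewrite openE => z Dz.
have h j : \forall w \near z, `|(w : 'rV[Cplx R]_n) ord0 j| < 1.
  have := Dz j; rewrite normCplx_lt1 => Dzj.
  have := @coord_continuous _ _ _ ord0 j z _
    (@continuous_sqmod R (z ord0 j) _ (lt_nbhsl Dzj)).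
  by apply: (@filterS _ _ (nbhs_filter z)) => w /=; rewrite normCplx_lt1.
exact: (filter_forall (nbhs_filter z)) h.
Qed.

Lemma continuous_affine {R : realType} n (a b : 'rV[Cplx R]_n) :
  continuous (fun l : Cplx R => a + l *: b).
Proof.
move=> l; have Fl := nbhs_filter l.
apply: cvgD; first exact: cvg_cst.
by apply: cvgZr_tmp; exact: cvg_id.
Qed.

(** * Upper semicontinuity *)

Lemma usc_on_comp {R : realType} (S T : topologicalType) (D : set T)
    (u : T -> \bar R) (f : S -> T) :
  continuous f -> usc_on D u -> usc_on [set x | D (f x)] (fun x => u (f x)).
Proof.
move=> cf uD x Dx c uxc.
by have := cf x _ (uD _ Dx _ uxc).
Qed.

Lemma usc_on_sublevel {R : realType} (T : topologicalType) (D : set T)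
    (u : T -> \bar R) (c : R) :
  open D -> usc_on D u -> open [set x | D x /\ (u x < c%:E)%E].
Proof.
move=> oD uD; rewrite openE => x [Dx uxc].
have nD : nbhs x D by apply: open_nbhs_nbhs.
by apply: filterS2 nD (uD _ Dx _ uxc) => y Dy yc; split; last exact: yc.
Qed.

(* Partial sums exceed any bound below the sum, and dominate from below nearby. *)
Lemma usc_on_opp_nneseries {R : realType} (T : topologicalType) (D : set T)
    (w : nat -> T -> R) : open D -> (forall m, continuous (w m)) ->
  (forall m x, D x -> 0 <= w m x) ->
  usc_on D (fun x => - (\sum_(0 <= m <oo) (w m x)%:E))%E.
Proof.
move=> oD cw w0 x Dx c; rewrite lteNl -EFinN => cS.
have [N cN] : exists N, - c < \sum_(0 <= m < N) w m x.
  apply: contrapT => /forallNP h.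
  move: cS; apply/negP; rewrite -leNgt; apply: lime_le.
    by apply: is_cvg_nneseries => m _ _; rewrite lee_fin w0.
  by near=> N; rewrite sumEFin lee_fin leNgt; apply/negP/h.
have cP : continuous (fun y => \sum_(0 <= m < N) w m y).
  move=> y; elim: N {cN} => [|N IH].
    by under [X in continuous_at _ X]eq_fun do rewrite big_geq//; exact: cvg_cst.
  under [X in continuous_at _ X]eq_fun do rewrite big_nat_recr//=.
  by apply: cvgD => //; exact: cw.
have Fx := nbhs_filter x.
have := @cvgr_gt _ _ _ Fx _ _ (cP x) _ cN.
apply: filterS => y yN Dy; rewrite lteNl -EFinN.
apply: lt_le_trans (nneseries_lim_ge N _).
  by rewrite sumEFin lte_fin.
by move=> m _ _; rewrite lee_fin w0.
Unshelve. all: by end_near. Qed.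

(** * Plurisubharmonicity of the logarithmic series *)

Definition log_term {R : realType} (eps e : R) (a x : Cplx R) : R :=
  eps * (ln 5 - ln (sqmod (x - a) + e)).

Lemma continuous_log_term {R : realType} (eps e : R) (a : Cplx R) : 0 < e ->
  continuous (log_term eps e a).
Proof.
move=> e0 x; have Fx := nbhs_filter x.
have cS : sqmod (y - a) + e @[y --> x] --> sqmod (x - a) + e.
  apply: cvgD; last exact: cvg_cst.
  apply: (@cvg_comp _ _ _ (fun y => y - a) (@sqmod R) _ (nbhs (x - a))).
    by apply: cvgB; [exact: cvg_id|exact: cvg_cst].
  exact: continuous_sqmod.
apply: cvgM; first exact: cvg_cst.
apply: cvgB; first exact: cvg_cst.
apply: (cvg_comp _ _ cS).
by apply: continuous_ln; rewrite ltr_wpDl// sqmod_ge0.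
Qed.

(** This is where 5 comes from: [|x - a|^2 <= 2 |x|^2 + 2 |a|^2 < 4] and [e <= 1]. *)
Lemma log_term_ge0 {R : realType} (eps e : R) (a x : Cplx R) :
  0 <= eps -> 0 < e <= 1 -> sqmod a < 1 -> sqmod x < 1 ->
  0 <= log_term eps e a x.
Proof.
move=> eps0 /andP[e0 e1] a1 x1; rewrite mulr_ge0// subr_ge0.
rewrite ler_ln ?posrE//; last by rewrite ltr_wpDl// sqmod_ge0.
move: a x a1 x1 => [a1 a2] [x1 x2]; rewrite /sqmod/= => h1 h2.
have := sqr_ge0 (x1 + a1); have := sqr_ge0 (x2 + a2); lra.
Qed.

Lemma log_term_circle {R : realType} (eps e : R) (a c d : Cplx R) (t : R) :
  log_term eps e a (c + d * expi t) =
  eps * (ln 5 - ln (sqmod (c - a + d * expi t) + e)).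
Proof. by rewrite /log_term [c + _ - a]addrAC. Qed.

Lemma measurable_log_term_circle {R : realType} (eps e : R) (a c d : Cplx R) :
  0 < e ->
  measurable_fun `[0, (2 * pi)]
    (EFin \o (fun t : R => log_term eps e a (c + d * expi t))).
Proof.
move=> e0; apply/measurable_EFinP; apply: measurable_funTS.
apply: measurable_realfun.continuous_measurable_fun.
under eq_fun do rewrite log_term_circle.
move=> t; apply: cvgM; first exact: cvg_cst.
by apply: cvgB; [exact: cvg_cst|exact: continuous_ln_sqmod_circle].
Qed.

Lemma norm_expi {R : realType} (t : R) : `|expi t| = 1.
Proof. by rewrite normCplxE /sqmod/= cos2Dsin2 sqrtr1. Qed.

(** As the terms are nonnegative on the polydisc, sum and circle integral commute even when the sum
    is infinite, and the mean inequality reduces to that of each term. *)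
Lemma plurisubharmonic_log_series {R : realType} n (eps e : nat -> R)
    (a : nat -> Cplx R) (k : nat -> 'I_n) :
  (forall m, 0 <= eps m) -> (forall m, 0 < e m <= 1) ->
  (forall m, sqmod (a m) < 1) ->
  plurisubharmonic (@polydisc R n) (fun z =>
    - \sum_(0 <= m <oo) (log_term (eps m) (e m) (a m) (z ord0 (k m)))%:E)%E.
Proof.
move=> eps0 e01 a1.
have e0 m : 0 < e m by have /andP[] := e01 m.
pose w m (z : 'rV[Cplx R]_n) := log_term (eps m) (e m) (a m) (z ord0 (k m)).
have w0 m z : polydisc z -> 0 <= w m z.
  by move=> Dz; apply: log_term_ge0 => //; rewrite -normCplx_lt1; exact: Dz.
have cw m : continuous (w m).
  move=> z; apply: (@continuous_comp _ _ _ (fun z : 'rV[Cplx R]_n => z ord0 (k m))).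
    exact: coord_continuous.
  exact: continuous_log_term.
have finw z : polydisc z -> (- \sum_(0 <= m <oo) (w m z)%:E < +oo)%E.
  move=> Dz; apply: (@le_lt_trans _ _ 0%E) => //.
  by rewrite oppe_le0; apply: nneseries_ge0 => m _ _; rewrite lee_fin w0.
have uscw := usc_on_opp_nneseries (@open_polydisc R n) cw w0.
split => // [|p b]; first exact: open_polydisc.
have cpb := @continuous_affine R n p b.
split.
- by apply: open_comp => [? _|]; [exact: cpb|exact: open_polydisc].
- by move=> l /finw.
- exact: usc_on_comp cpb uscw.
move=> alpha r r0 sub.
pose z t : 'rV[Cplx R]_n := p + (alpha + (r%:C)%C * expi t) *: b.
have Dz t : polydisc (z t).
  apply: sub => /=; rewrite addrC addKr normrM norm_expi mulr1.
  by rewrite ger0_norm// (lecR 0) ltW.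
(* On the circle the coordinate [k m] equals [c m + d m * expi t]; [d m] is 0 when the line is
   parallel to the hyperplane. *)
pose c m := p ord0 (k m) + alpha * b ord0 (k m).
pose d m := (r%:C)%C * b ord0 (k m).
have wz m t : w m (z t) = log_term (eps m) (e m) (a m) (c m + d m * expi t).
  by rewrite /w !mxE mulrDl addrA [in LHS]mulrAC.
have twopi : (0 : R) < 2 * pi by rewrite mulr_gt0// pi_gt0.
rewrite /circle_mean.
rewrite (_ : (fun t => _) = fun t => (- \sum_(0 <= m <oo) (w m (z t))%:E)%E)//.
rewrite integral_ge0N; last first.
  by move=> t _; apply: nneseries_ge0 => m _ _; rewrite lee_fin w0.
rewrite integral_nneseries//; last 2 first.
- move=> m; apply: eq_measurable_fun (measurable_log_term_circle _ _ (c m) (d m) (e0 m)).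
  by move=> t _ /=; rewrite wz.
- by move=> m t _; rewrite lee_fin w0.
rewrite muleN leeN2 -nneseriesZl; last first.
  by move=> m _; apply: integral_ge0 => t _; rewrite lee_fin w0.
apply: lee_nneseries => m _.
  rewrite mule_ge0 ?lee_fin ?invr_ge0 ?(ltW twopi)//.
  by apply: integral_ge0 => t _; rewrite lee_fin w0.
rewrite -lee_pdivlMl ?invr_gt0// invrK -EFinM.
under eq_integral do rewrite wz log_term_circle.
rewrite [log_term _ _ _ _](_ : _ = eps m * (ln 5 - ln (sqmod (c m - a m) + e m))).
  exact: integral_neg_log_le.
by rewrite /log_term !mxE.
Qed.

(** * Zeros of a local equation on rational hyperplanes *)

Lemma derive1_neq0_change_sign {R : realType} (f : R -> R) (eps : R) :
  0 < eps -> f 0 = 0 -> derivable f 0 1 -> 'D_1 f 0 != 0 ->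
  exists2 t, 0 < t < eps & f t * f (- t) < 0.
Proof.
move=> eps0 f0 df; set c := 'D_1 f 0 => c0.
(* Multiplying the difference quotient by [c] makes its limit positive whatever the sign of the
   derivative. *)
have cvf : h^-1 *: ((f \o shift 0) (h *: 1) - f 0) * c @[h --> (0 : R)^'] --> c * c.
  by apply: cvgM; [exact: df|exact: cvg_cst].
have cc0 : 0 < c * c by rewrite -expr2 lt_def sqr_ge0 sqrf_eq0 c0.
have [d /= d0 dP] := @cvgr_gt _ _ _ _ _ _ cvf _ cc0.
have sgn h : h != 0 -> `|h| < d -> 0 < h^-1 * f h * c.
  move=> h0 hd; have := dP h; rewrite /ball/= sub0r normrN => /(_ hd h0).
  by rewrite f0 addr0 subr0 /GRing.scale/= mulr1.
pose t := Num.min d eps / 2.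
have m0 : 0 < Num.min d eps by rewrite lt_min d0.
have t0 : 0 < t by rewrite divr_gt0.
have tm : t < Num.min d eps by rewrite /t; lra.
move: (tm); rewrite lt_min => /andP[td te].
exists t; first by rewrite t0.
have tn0 : t != 0 by rewrite gt_eqF.
have := sgn t tn0; rewrite gtr0_norm// => /(_ td) h1.
have := sgn (- t); rewrite oppr_eq0 normrN gtr0_norm// => /(_ tn0 td) h2.
have : 0 < (t^-1 * f t * c) * ((- t)^-1 * f (- t) * c) by rewrite mulr_gt0.
have -> : (t^-1 * f t * c) * ((- t)^-1 * f (- t) * c) =
  - (f t * f (- t)) * (c / t) ^+ 2 by field.
by rewrite pmulr_lgt0 ?oppr_gt0// lt_def sqr_ge0 andbT sqrf_eq0 mulf_neq0// invr_eq0.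
Qed.

Lemma real_line0 {R : realType} n (rho : 'rV[Cplx R]_n -> R) z v :
  real_line rho z v 0 = rho z.
Proof. by rewrite /real_line rmorph0 scale0r addr0. Qed.

Lemma real_lineD {R : realType} n (rho : 'rV[Cplx R]_n -> R) z v s t :
  real_line rho (z + (s%:C)%C *: v) v t = real_line rho z v (s + t).
Proof. by rewrite /real_line -addrA -scalerDl -rmorphD. Qed.

(** [C1_on] differentiates at parameter 0 from each base point; the intermediate value theorem needs
    one line with all its parameters. *)
Lemma derivable_real_line {R : realType} n (rho : 'rV[Cplx R]_n -> R) z v s :
  derivable (real_line rho (z + (s%:C)%C *: v) v) 0 1 ->
  derivable (real_line rho z v) s 1.
Proof.
set g := real_line rho z v; set g' := real_line rho _ v.
have g'E t : g' t = g (s + t) by rewrite /g' real_lineD.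
have -> : g = g' \o (fun t => t - s) by apply/funext => t /=; rewrite g'E subrKC.
move=> dg'; apply/derivable1_diffP/differentiable_comp.
  exact: differentiableB.
by rewrite subrr; apply/derivable1_diffP.
Qed.

Lemma norm_real_dir_le1 {R : realType} n (j : 'I_n) (b : bool) i l :
  `|real_dir R j b i l| <= 1.
Proof.
rewrite /real_dir !mxE normrM.
have -> : `|if b then 'i else 1| = 1 :> Cplx R.
  by case: b; [exact: normCi|exact: normr1].
by rewrite mul1r; case: andP => _; rewrite ?normr1 ?normr0.
Qed.

Lemma mulr_lt0_min_max {R : realDomainType} (x y : R) :
  x * y < 0 -> Num.min x y <= 0 <= Num.max x y.
Proof.
rewrite ge_min le_max; case: (ltgtP x 0) => [x0|x0|->]; last by rewrite mul0r ltxx.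
  by rewrite nmulr_rlt0// => /ltW ->.
by rewrite pmulr_rlt0// => /ltW ->.
Qed.

Lemma addZmxE {K : pzRingType} m n (A B : 'M[K]_(m, n)) (a : K) i l :
  (A + a *: B) i l = A i l + a * B i l.
Proof. by rewrite !mxE. Qed.

Lemma addr3K {K : zmodType} (x a b c : K) : x + a + b + c - x = c + a + b.
Proof. by rewrite addrC -!addrA addKr addrA addrC addrA. Qed.

Lemma addr3_rot {K : zmodType} (x a b c : K) : x + a + b + c = x + b + c + a.
Proof. by rewrite -!addrA; congr (_ + _); rewrite addrC addrA. Qed.

Lemma addr_realscale0 {R : realType} (K : lmodType (Cplx R)) (x w : K) :
  x + ((0 : R)%:C)%C *: w = x.
Proof. by rewrite rmorph0 scale0r addr0. Qed.

(** Radii are elements of [Cplx R]; positivity forces their imaginary part to vanish. *)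
Lemma nbhs_real_ball {R : realType} n (z : 'rV[Cplx R]_n) (B : set 'rV[Cplx R]_n) :
  nbhs z B -> exists2 e : R, 0 < e & ball z ((e%:C)%C : Cplx R) `<=` B.
Proof.
move=> /nbhs_ballP[e /= e0 zB].
have eE : ((complex.Re e)%:C)%C = e.
  move: e0; rewrite (ltcE 0)/= => /andP[/eqP + _].
  by case: (e) => x y /= ->.
exists (complex.Re e); last by rewrite eE.
by move: e0; rewrite (ltcE 0)/= => /andP[].
Qed.

(** The rational is sought just to the right of [x], and below 0 when [x] is negative, so that it
    cannot be 0. This later keeps the hyperplane away from the origin. *)
Lemma rational_shift {R : realType} (x : R) (P : set R) : nbhs 0 P ->
  exists2 h, P h & exists2 y : rat, x + h = ratr y & ratr y != 0 :> R.
Proof.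
move=> /nbhs_ballP[e /= e0 eP].
have [y yP y0] : exists2 y : rat, ratr y \in `]x, (x + e)[ & ratr y != 0 :> R.
  have [x0|x0] := leP 0 x.
    have [|y yI] := @rat_in_itvoo R x (x + e); first by rewrite ltrDl.
    exists y => //; rewrite gt_eqF//; move: yI; rewrite in_itv/=.
    by move=> /andP[/(le_lt_trans x0)].
  have [|y yI] := @rat_in_itvoo R x (Num.min 0 (x + e)).
    by rewrite lt_min x0 ltrDl.
  move: yI; rewrite in_itv/= lt_min => /and3P[xy y0 ye].
  by exists y; rewrite ?lt_eqF// in_itv/= xy.
move: yP; rewrite in_itv/= => /andP[xy ye].
exists (ratr y - x); last by exists y; rewrite ?subrKC.
by apply: eP; rewrite /ball/= sub0r normrN gtr0_norm ?subr_gt0// ltrBlDl.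
Qed.

Lemma hypersurface_meets_rational_hyperplane {R : realType} n (M V : set 'rV[Cplx R]_n)
    (p : 'rV[Cplx R]_n) : (2 <= n)%N ->
  real_hypersurface M -> open V -> M p -> V p ->
  exists (q : 'rV[Cplx R]_n) (k : 'I_n) (x y : rat),
    [/\ M q, V q, q ord0 k = (ratr x +i* ratr y)%C & ratr x != 0 :> R].
Proof.
move=> n2 HM oV Mp Vp.
have [U [rho [oU Up C1 grad MU]]] := HM p Mp.
have rho_p : rho p = 0.
  by have : (M `&` U) p by []; rewrite MU => -[].
have : nbhs p (U `&` V) by apply: open_nbhs_nbhs; split; [exact: openI|].
move=> /nbhs_real_ball[e e0 ballUV].
have e3 : e / 3 < e by lra.
have [j [b Dne]] := grad p Up.
have [k kj] : exists k : 'I_n, k != j.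
  (* As [n >= 2], one of the indices 0 and 1 differs from [j]. *)
  exists (if j == Ordinal (ltnW n2) then Ordinal n2 else Ordinal (ltnW n2)).
  by case: (eqVneq j (Ordinal (ltnW n2))) => [->|]; rewrite // eq_sym.
have [v vE] : {v | v = real_dir R j b} by exists (real_dir R j b).
have [v1 v1E] : {v | v = real_dir R k false} by exists (real_dir R k false).
have [v2 v2E] : {v | v = real_dir R k true} by exists (real_dir R k true).
(* [s] runs along the direction in which [rho] changes sign; [h1] and [h2] adjust the real and
   imaginary parts of coordinate [k]. *)
pose Q s h1 h2 : 'rV[Cplx R]_n :=
  p + (h1%:C)%C *: v1 + (h2%:C)%C *: v2 + (s%:C)%C *: v.
have QE s h1 h2 i l : Q s h1 h2 i l = p i l + (h1%:C)%C * v1 i l +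
    (h2%:C)%C * v2 i l + (s%:C)%C * v i l by rewrite /Q !addZmxE.
(* The balls are those of the sup norm and the directions have entries of modulus at most 1, so each
   of the three parameters may use [e / 3]. *)
have QUV (s h1 h2 : R) : `|s| + `|h1| + `|h2| < e -> (U `&` V) (Q s h1 h2).
  move=> lte; apply: ballUV; split => [|i l]; first by rewrite (ltcR 0).
  rewrite /ball/= QE distrC.
  have -> : p i l + (h1%:C)%C * v1 i l + (h2%:C)%C * v2 i l + (s%:C)%C * v i l
      - p i l = (s%:C)%C * v i l + (h1%:C)%C * v1 i l + (h2%:C)%C * v2 i l.
    exact: addr3K.
  apply: (@le_lt_trans _ _ ((`|s| + `|h1| + `|h2|)%:C)%C); last by rewrite ltcR.
  have nle t w : `|w i l| <= 1 -> `|(t%:C)%C * w i l| <= (`|t|%:C)%C.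
    move=> w1; rewrite normrM normc_def/= expr0n/= addr0 sqrtr_sqr.
    by rewrite ler_piMr// (lecR 0).
  rewrite !rmorphD/=.
  apply: (le_trans (ler_normD _ _)); apply: lerD.
    apply: (le_trans (ler_normD _ _)); apply: lerD; apply: nle.
      by rewrite vE norm_real_dir_le1.
    by rewrite v1E norm_real_dir_le1.
  by apply: nle; rewrite v2E norm_real_dir_le1.
have derQ (s h1 h2 : R) l c : `|s| + `|h1| + `|h2| < e ->
    derivable (real_line rho (Q s h1 h2) (real_dir R l c)) 0 1.
  by move=> /QUV[UQ _]; have [] := C1 l c _ UQ.
have contQ (s h1 h2 : R) w l c : w = real_dir R l c -> `|s| + `|h1| + `|h2| < e ->
    real_line rho (Q s h1 h2) w h @[h --> 0] --> rho (Q s h1 h2).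
  move=> -> lte; have := derQ s h1 h2 l c lte.
  rewrite -[X in _ --> X](real_line0 rho (Q s h1 h2) (real_dir R l c)).
  by move=> /derivable1_diffP/differentiable_continuous.
have [t /andP[t0 te] ft] : exists2 t, 0 < t < e / 3 &
    rho (Q t 0 0) * rho (Q (- t) 0 0) < 0.
  have Q0 s : real_line rho p v s = rho (Q s 0 0).
    by rewrite /Q (addr_realscale0 p v1) (addr_realscale0 p v2).
  have [||||t te] := @derive1_neq0_change_sign _ (real_line rho p v) (e / 3).
  - by rewrite divr_gt0.
  - by rewrite real_line0.
  - by rewrite vE; have [] := C1 j b _ Up.
  - by rewrite vE; exact: Dne.
  by rewrite !Q0; exists t.
have Q1 s h h2 : Q s h h2 = Q s 0 h2 + (h%:C)%C *: v1.
  by rewrite /Q (addr_realscale0 p v1); exact: addr3_rot.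
have Q2 s h1 h : Q s h1 h = Q s h1 0 + (h%:C)%C *: v2.
  by rewrite /Q (addr_realscale0 (p + (h1%:C)%C *: v1) v2); exact: addrAC.
have small : \forall h \near (0 : R), `|h| < e / 3.
  by apply: nbhs0_lt; rewrite divr_gt0.
(* Strict opposition of signs survives small shifts. Only continuity of [rho] along single real
   coordinate lines is at hand, hence two successive shifts. *)
have [h1 [h1e f1] [x xE x0]] : exists2 h1, `|h1| < e / 3 /\
    rho (Q t h1 0) * rho (Q (- t) h1 0) < 0 &
    exists2 x : rat, complex.Re (p ord0 k) + h1 = ratr x & ratr x != 0 :> R.
  apply: rational_shift; apply: filterI; first exact: small.
  have te0 : `|t| + `|0 : R| + `|0 : R| < e by rewrite normr0 gtr0_norm// !addr0 (lt_trans te).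
  have te1 : `|- t| + `|0 : R| + `|0 : R| < e by rewrite normrN.
  have cM := @cvgM R _ _ (nbhs_filter (0 : R)) _ _ _ _ (contQ t 0 0 _ _ _ v1E te0) (contQ (- t) 0 0 _ _ _ v1E te1).
  have := @cvgr_lt _ _ _ (nbhs_filter (0 : R)) _ _ cM _ ft.
  apply: filterS => h.
  by rewrite /= /real_line -(Q1 t h 0) -(Q1 (- t) h 0).
have [h2 [h2e f2] [y yE _]] : exists2 h2, `|h2| < e / 3 /\
    rho (Q t h1 h2) * rho (Q (- t) h1 h2) < 0 &
    exists2 y : rat, complex.Im (p ord0 k) + h2 = ratr y & ratr y != 0 :> R.
  apply: rational_shift; apply: filterI; first exact: small.
  have te0 : `|t| + `|h1| + `|0 : R| < e.
    rewrite normr0 gtr0_norm// addr0; clear -te h1e e0; lra.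
  have te1 : `|- t| + `|h1| + `|0 : R| < e by rewrite normrN.
  have cM := @cvgM R _ _ (nbhs_filter (0 : R)) _ _ _ _ (contQ t h1 0 _ _ _ v2E te0) (contQ (- t) h1 0 _ _ _ v2E te1).
  have := @cvgr_lt _ _ _ (nbhs_filter (0 : R)) _ _ cM _ f1.
  apply: filterS => h.
  by rewrite /= /real_line -(Q2 t h1 h) -(Q2 (- t) h1 h).
have se s : s \in `[- t, t] -> `|s| + `|h1| + `|h2| < e.
  by rewrite in_itv/= -ler_norml => st; clear -st te h1e h2e; lra.
pose g := real_line rho (Q 0 h1 h2) v.
have gE s : g s = rho (Q s h1 h2).
  by rewrite /g /real_line /Q (addr_realscale0 (p + (h1%:C)%C *: v1 + (h2%:C)%C *: v2) v).
(* Moving along [v] leaves coordinate [k] fixed, so this zero lies on the rational hyperplane. *)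
have [s sI gs0] : exists2 s, s \in `[- t, t] & g s = 0.
  apply: IVT; first by rewrite ge0_cp// ltW.
    apply: derivable_within_continuous => s /se lte.
    apply: derivable_real_line; rewrite /g.
    have := derQ s h1 h2 j b lte; rewrite -vE.
    by rewrite /Q (addr_realscale0 (p + (h1%:C)%C *: v1 + (h2%:C)%C *: v2) v).
  by rewrite (gE t) (gE (- t)); apply: mulr_lt0_min_max; rewrite mulrC.
have [UQ VQ] := QUV _ _ _ (se _ sI).
exists (Q s h1 h2), k, x, y; split => //.
  have : [set z | U z /\ rho z = 0] (Q s h1 h2) by split; rewrite -?gE.
  by rewrite -MU => -[].
have [v1k v2k vk] : [/\ v1 ord0 k = 1, v2 ord0 k = 'i & v ord0 k = 0].
  rewrite v1E v2E vE /real_dir; split.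
  - by rewrite scale1r mxE !eqxx.
  - by rewrite [LHS]mxE [X in _ * X]mxE !eqxx mulr1.
  - by rewrite [LHS]mxE [X in _ * X]mxE (negbTE kj) andbF mulr0.
rewrite QE v1k v2k vk mulr0 addr0 mulr1 -complexiE -xE -yE.
by case: (p ord0 k) => pr qr; apply/eqP; rewrite eq_complex /=; apply/andP; split; apply/eqP; ring.
Qed.

(** * Density of the hyperplanes and choice of the coefficients *)

Lemma rational_coordinate_dense {R : realType} n (z : 'rV[Cplx R]_n) (k : 'I_n)
    (B : set 'rV[Cplx R]_n) : nbhs z B ->
  exists q (x y : rat), [/\ B q, q ord0 k = (ratr x +i* ratr y)%C & ratr x != 0 :> R].
Proof.
move=> /nbhs_real_ball[e e0 zB].
have small : \forall h \near (0 : R), `|h| < e / 2.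
  by apply: nbhs0_lt; rewrite divr_gt0.
have [h1 h1e [x xE x0]] := rational_shift (complex.Re (z ord0 k)) small.
have [h2 h2e [y yE _]] := rational_shift (complex.Im (z ord0 k)) small.
have he : `|(h1 +i* h2)%C : Cplx R| < (e%:C)%C.
  rewrite normCplxE /sqmod/= ltcR -[ltRHS]gtr0_norm// -sqrtr_sqr.
  rewrite ltr_sqrt ?exprn_gt0//.
  have e2 : 0 <= e / 2 by rewrite divr_ge0// ltW.
  rewrite -(@real_normK _ h1) ?num_real// -(@real_normK _ h2) ?num_real//.
  have a1 : `|h1| ^+ 2 < (e / 2) ^+ 2 by rewrite ltr_sqr ?nnegrE.
  have a2 : `|h2| ^+ 2 < (e / 2) ^+ 2 by rewrite ltr_sqr ?nnegrE.
  have e20 : 0 < e ^+ 2 by rewrite exprn_gt0.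
  by move: a1 a2; rewrite expr_div_n; lra.
exists (z + (h1 +i* h2)%C *: delta_mx ord0 k), x, y; split => //.
  apply: zB; split => [|i l]; first by rewrite (ltcR 0).
  rewrite /ball/= addZmxE opprD addNKr normrN normrM mxE.
  by case: andP => _; rewrite ?normr1 ?normr0 ?mulr1 ?mulr0// (ltcR 0).
rewrite addZmxE mxE !eqxx mulr1 -xE -yE.
by case: (z ord0 k) => zr zi.
Qed.

(** With [L = ln 5 - ln |a|^2], the value at 0 is at most [eps L] for every [e > 0], so
    [eps = eta / L] is fixed first. Then [e = exp (- 3 / eps)] makes the value at [a] equal to
    [eps ln 5 + 3]. If [a] is 0 or outside the disc, the zero term is taken. *)
Lemma log_term_coefficients {R : realType} (a : Cplx R) (eta : R) : 0 < eta ->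
  exists c : R * R, [/\ 0 <= c.1, 0 < c.2 <= 1, log_term c.1 c.2 a 0 <= eta &
    0 < sqmod a < 1 -> 3 <= log_term c.1 c.2 a a].
Proof.
move=> eta0; have [/andP[a0 a1]|na] := boolP (0 < sqmod a < 1); last first.
  exists (0, 1); split; rewrite /= ?ltr01 ?lexx//.
  by rewrite /log_term mul0r ltW.
pose L := ln 5 - ln (sqmod a).
have L0 : 0 < L by rewrite subr_gt0 ltr_ln ?posrE//; lra.
have eps0 : 0 < eta / L by rewrite divr_gt0.
exists (eta / L, expR (- (3 / (eta / L)))); split => /=.
- exact: ltW.
- by rewrite expR_gt0 -expR0 ler_expR oppr_le0 divr_ge0// ltW.
- rewrite /log_term -[leRHS](divfK (lt0r_neq0 L0)) ler_wpM2l ?(ltW eps0)//.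
  rewrite lerD2l lerN2 sub0r.
  have -> : sqmod (- a) = sqmod a by case: (a) => ? ?; rewrite /sqmod/= !sqrrN.
  rewrite ler_ln ?posrE//; first by rewrite lerDl expR_ge0.
  exact: addr_gt0 a0 (expR_gt0 _).
- move=> _; rewrite /log_term subrr.
  have -> : sqmod (0 : Cplx R) = 0 by rewrite /sqmod/= expr0n addr0.
  rewrite add0r expRK opprK mulrDr mulrCA divff ?gt_eqF// mulr1 lerDr.
  by rewrite mulr_ge0 ?(ltW eps0)// ln_ge0; lra.
Qed.

(** * Construction of the set *)

Theorem propositionA (R : realType) (n : nat) (hn : (2 <= n)%N) :
  exists A : set 'rV[Cplx R]_n,
    [/\ open A,
        A `<=` @polydisc R n,
        @polydisc R n `<=` closure A,
        plurithin A 0 &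
        ~ exists M C : set 'rV[Cplx R]_n,
            [/\ real_hypersurface M,
                C !=set0,
                exists2 V : set 'rV[Cplx R]_n, open V & C = M `&` V &
                C `<=` @polydisc R n `\` A]].
Proof.
pose idx (m : nat) : 'I_n * (rat * rat) := odflt (Ordinal hn, (0, 0)) (unpickle m).
pose a0 (m : nat) : Cplx R := (ratr (idx m).2.1 +i* ratr (idx m).2.2)%C.
(* Centres outside the disc are replaced by 0, for which [log_term_coefficients] promises no lower
   bound. *)
pose a m := if sqmod (a0 m) < 1 then a0 m else 0.
have a1 m : sqmod (a m) < 1.
  rewrite /a; case: ifPn => // _.
  by rewrite /sqmod/= expr0n addr0.
have /choice[c cP] (m : nat) := @log_term_coefficients R (a m) (1 / (2 ^ m.+1)%:R)
  ltac:(by rewrite divr_gt0// ltr0n expn_gt0).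
have eps0 m : 0 <= (c m).1 by case: (cP m).
have e01 m : 0 < (c m).2 <= 1 by case: (cP m).
pose w m (z : 'rV[Cplx R]_n) := log_term (c m).1 (c m).2 (a m) (z ord0 (idx m).1).
pose u (z : 'rV[Cplx R]_n) := (- \sum_(0 <= m <oo) (w m z)%:E)%E.
have w0 m z : polydisc z -> 0 <= w m z.
  by move=> Dz; apply: log_term_ge0 => //; rewrite -normCplx_lt1; exact: Dz.
have pshu : plurisubharmonic (@polydisc R n) u.
  exact: plurisubharmonic_log_series eps0 e01 a1.
(* The level -2 separates [u <= -3] on the hyperplanes from [u 0 >= -1]. *)
pose A := [set z | polydisc z /\ (u z < (-2)%:E)%E].
have AP z k (x y : rat) : polydisc z -> z ord0 k = (ratr x +i* ratr y)%C ->
    ratr x != 0 :> R -> A z.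
  move=> Dz zk x0; split=> //.
  pose m := pickle (k, (x, y)).
  have idxm : idx m = (k, (x, y)) by rewrite /idx pickleK.
  have a0m : a0 m = z ord0 k by rewrite /a0 idxm zk.
  have zk1 : sqmod (z ord0 k) < 1 by rewrite -normCplx_lt1; exact: Dz.
  have am : a m = z ord0 k by rewrite /a a0m zk1.
  have wm : 3 <= w m z.
    rewrite /w idxm/= -am; case: (cP m) => _ _ _; apply.
    by rewrite a1 am zk andbT ltr_wpDr ?sqr_ge0// lt_def sqrf_eq0 x0 sqr_ge0.
  rewrite /u lteNl -EFinN opprK; apply: (@lt_le_trans _ _ (w m z)%:E).
    by rewrite lte_fin; lra.
  (* The partial sum below [m.+1] is the first one to contain the term [w m z]. *)
  apply: le_trans (nneseries_lim_ge m.+1 _); last first.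
    by move=> i _ _; rewrite lee_fin w0.
  rewrite big_nat_recr//= leeDr// sume_ge0// => i _.
  by rewrite lee_fin w0.
have D0 : polydisc (0 : 'rV[Cplx R]_n) by move=> j; rewrite mxE normr0 ltr01.
have densA : @polydisc R n `<=` closure A.
  move=> z Dz B zB.
  have zBD : nbhs z (B `&` @polydisc R n).
    by apply: filterI => //; apply: open_nbhs_nbhs; split; [exact: open_polydisc|].
  have [q [x [y [[Bq Dq] qk x0]]]] := rational_coordinate_dense (Ordinal hn) zBD.
  by exists q; split => //; exact: AP Dq qk x0.
exists A; split => //.
- by apply: usc_on_sublevel; [exact: open_polydisc|case: pshu].
- by move=> z [].
- right; split; first exact: densA.
  exists (@polydisc R n), u; split => //.
  apply: (@le_lt_trans _ _ (-2)%:E).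
    (* The upper limit is at most the supremum over all of [A] without 0, hence at most -2. *)
    apply: ge_ereal_inf; exists (ereal_sup (u @` (A `\ 0))); last first.
      by apply: ge_ereal_sup => _ [z [[_ /ltW uz] _] <-].
    by exists (A `\ 0) => //; exact: withinT.
  rewrite /u lteNr -EFinN opprK; apply: (@le_lt_trans _ _ 1%:E).
    (* The bounds [1 / 2^(m+1)] on the terms at 0 add up to at most 1. *)
    apply: le_trans (@epsilon_trick0 R 1 xpredT ler01).
    apply: lee_nneseries => m _; first by rewrite lee_fin w0.
    by rewrite lee_fin /w mxE; case: (cP m).
  by rewrite lte_fin; lra.
move=> [M [C [HM [p Cp] [V oV CMV] CA]]].
have [Mp Vp] : M p /\ V p by move: Cp; rewrite CMV.
have [q [k [x [y [Mq Vq qk x0]]]]] :=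
  hypersurface_meets_rational_hyperplane hn HM oV Mp Vp.
have [Dq nAq] : (@polydisc R n `\` A) q by apply: CA; rewrite CMV.
exact: nAq (AP _ _ _ _ Dq qk x0).
Qed.
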